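(* Let $A$ be either a simplicial complex whose vertex set is totally ordered or a small category, with a chosen base vertex $a_0\in V(A)$, and let $S=S(A)$ be the associated pointed simplicial set. Let $G$ be a simplicial group and $\delta\colon V(A)\to\mathrm{End}(G)$ a twisted structure on $A$ with coefficients in $G$. Then: 1. The sequence of groups $F^{G,\Delta}_{\delta}[A]=\{F^G[A]_n\}_{n\ge 0}$ with the twisted face operations $d_i^\delta$ forms a $\Delta$-group. 2. Suppose that the twisted structure $\delta$ is non-singular. Then the sequence of groups $F^{G}_{\delta}[A]=\{F^G[A]_n\}_{n\ge0}$ with the twisted face operations $d_i^\delta$ and the twisted degeneracy operations $s_i^\delta$ forms a simplicial group.
   Context: **The simplicial set $S(A)$.** $V(A)$ denotes the set of vertices of $A$ (if $A$ is a simplicial complex) or the set of objects of $A$ (if $A$ is a small category). - If $A=K$ is a simplicial complex with totally ordered vertex set, $S(K)_n$ is the set of sequences $(v_0,\dots,v_n)$ of vertices with $v_0\le v_1\le\cdots\le v_n$ such that $\{v_0,\dots,v_n\}$ is a simplex of $K$. The face $d_i$ deletes $v_i$, and the degeneracy $s_i$ repeats $v_i$. - If $A=\mathcal C$ is a small category, $S(\mathcal C)$ is its nerve. Thus $S_0=V(\mathcal C)$ and $S_n$ ($n\geq 1$) is the set of $n$-paths $v_0\alpha_1v_1\cdots\alpha_nv_n$ with $\alpha_i\colon v_{i-1}\to v_i$ morphisms. The face $d_i$ deletes $v_i$ and composes $\alpha_{i+1}\circ\alpha_i$ (and $d_0$, $d_n$ delete the first, respectively last, vertex together with its arrow). The degeneracy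 $s_i$ repeats $v_i$, inserting the identity of $v_i$. In both cases an $n$-simplex $x$ has vertices $v_0,\dots,v_n$. The basepoint of $S_n$ is the constant simplex $a_0^n$ at $a_0$ (that is, $s_0^n a_0$). **Twisted structure.** $\mathrm{End}(G)$ is the monoid of simplicial endomorphisms of $G$ (graded group endomorphisms commuting with all faces and degeneracies). A twisted structure on $A$ with coefficients in $G$ is a function $\delta\colon V(A)\to\mathrm{End}(G)$, $v\mapsto\delta_v$, such that $\delta_v\circ\delta_w=\delta_w\circ\delta_v$ whenever there is an edge joining $v$ and $w$ (simplicial complex case) or an arrow from $v$ to $w$ or from $w$ to $v$ (category case). It is non-singular if every $\delta_v$ is a simplicial automorphism. **The groups and operations.** $F^G[A]_n$ is the quotient of the free product $\ast_{x\in S_n}(G_n)_x$ of copies $(G_n)_x$ of $G_n$ by the relations $(G_n)_{a_0^n}=\{1\}$. Write $g_x$ for the element $g\in G_n$ in the copy $(G_n)_x$. For $x\in S_n$ with vertices $v_0,\dots,v_n$, the twisted face $d_i^\delta\colon F^G[A]_n\to F^G[A]_{n-1}$ ($0\le i\le n$, $n\ge1$) is the group homomorphism determined by $$d_i^\delta(g_x)=(\delta_{v_i}(d_ig))_{d_ix},$$ and, if $\delta$ is non-singular, the twisted degeneracy $s_i^\delta\colon F^G[A]_n\to F^G[A]_{n+1}$ ($0\le i\le n$) is the group homomorphism determined by $$s_i^\delta(g_x)=(\delta_{v_i}^{-1}(s_ig))_{s_ix}.$$ **$\Delta$-groups.** A $\Delta$-set is a sequence of sets $X=\{X_n\}_{n\ge0}$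 with maps $d_i\colon X_n\to X_{n-1}$, $0\le i\le n$, satisfying $d_id_j=d_jd_{i+1}$ for $i\ge j$. It is a $\Delta$-group if each $X_n$ is a group and each $d_i$ is a group homomorphism. *)

(* Defs.v *)
From HB Require Import structures.
From mathcomp Require Import all_boot all_order finmap boolp zify.

Set Implicit Arguments.
Unset Strict Implicit.
Unset Printing Implicit Defensive.

Import Order.TTheory.
Local Open Scope group_scope.
Local Open Scope fset_scope.
Local Open Scope quotient_scope.

Definition faces (X : nat -> Type) := forall n, 'I_n.+2 -> X n.+1 -> X n.
Definition degens (X : nat -> Type) := forall n, 'I_n.+1 -> X n -> X n.+1.

(* Every use of [inord] below is in range, so that [inord k] has value [k];
   it only adjusts the bound of the ordinal. *)
Definition is_delta_set (X : nat -> Type) (d : faces X) : Prop :=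
  forall n (i j : 'I_n.+2) (x : X n.+2), (j <= i)%N ->
    d n i (d n.+1 (inord j) x) = d n j (d n.+1 (inord i.+1) x).

(* The indices are shifted so that no predecessor occurs: [d_degen_lt] is
   d_i s_j = s_(j-1) d_i for i < j, stated at j+1, and [d_degen_gt] is
   d_i s_j = s_j d_(i-1) for i > j+1, stated at i+1. *)
Record is_simplicial_set (X : nat -> Type) (d : faces X) (s : degens X) : Prop :=
  IsSimplicialSet {
    d_d : is_delta_set d;
    s_s : forall n (i j : 'I_n.+1) (x : X n), (i <= j)%N ->
      s n.+1 (inord i) (s n j x) = s n.+1 (inord j.+1) (s n i x);
    d_degen_lt : forall n (i : 'I_n.+2) (j : 'I_n.+1) (x : X n.+1), (i <= j)%N ->
      d n.+1 (inord i) (s n.+1 (inord j.+1) x) = s n j (d n i x);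
    d_degen_eq : forall n (j : 'I_n.+1) (x : X n), d n (inord j) (s n j x) = x;
    d_degen_eqS : forall n (j : 'I_n.+1) (x : X n), d n (inord j.+1) (s n j x) = x;
    d_degen_gt : forall n (i : 'I_n.+2) (j : 'I_n.+1) (x : X n.+1), (j < i)%N ->
      d n.+1 (inord i.+1) (s n.+1 (inord j) x) = s n j (d n i x)
  }.

Record simplicial_set := SimplicialSet {
  sset_sort :> nat -> Type;
  sset_d : faces sset_sort;
  sset_s : degens sset_sort;
  sset_ax : is_simplicial_set sset_d sset_s
}.

Fixpoint const_simplex (X : simplicial_set) (x0 : X 0%N) n : X n :=
  if n is m.+1 then sset_s ord0 (const_simplex x0 m) else x0.

Definition is_delta_group (X : nat -> groupType) (d : faces X) : Prop :=
  (forall n (i : 'I_n.+2), {morph d n i : x y / x * y}) /\ is_delta_set d.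

Definition is_simplicial_group (X : nat -> groupType) (d : faces X)
    (s : degens X) : Prop :=
  [/\ forall n (i : 'I_n.+2), {morph d n i : x y / x * y},
      forall n (i : 'I_n.+1), {morph s n i : x y / x * y}
    & is_simplicial_set d s].

Record simplicial_group := SimplicialGroup {
  sgroup_sort :> nat -> groupType;
  sgroup_d : faces sgroup_sort;
  sgroup_s : degens sgroup_sort;
  sgroup_ax : is_simplicial_group sgroup_d sgroup_s
}.

Section SimplicialGroupMorphisms.
Variable G : simplicial_group.

Lemma sgroup_dM n (i : 'I_n.+2) :
  {morph @sgroup_d G n i : x y / x * y}.
Proof. by have [+ _ _] := sgroup_ax G; apply. Qed.

Lemma sgroup_sM n (i : 'I_n.+1) :
  {morph @sgroup_s G n i : x y / x * y}.
Proof. by have [_ + _] := sgroup_ax G; apply. Qed.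

HB.instance Definition _ n (i : 'I_n.+2) :=
  isMultiplicative.Build (G n.+1) (G n) (@sgroup_d G n i) (sgroup_dM i).
HB.instance Definition _ n (i : 'I_n.+1) :=
  isMultiplicative.Build (G n) (G n.+1) (@sgroup_s G n i) (sgroup_sM i).

Record simplicial_endo := SimplicialEndo {
  endo_fun :> forall n, {multiplicative G n -> G n};
  endo_d : forall n (i : 'I_n.+2) (g : G n.+1),
    endo_fun n (sgroup_d i g) = sgroup_d i (endo_fun n.+1 g);
  endo_s : forall n (i : 'I_n.+1) (g : G n),
    endo_fun n.+1 (sgroup_s i g) = sgroup_s i (endo_fun n g)
}.

Definition endo_inverse (f f' : simplicial_endo) : Prop :=
  forall n, cancel (f n) (f' n) /\ cancel (f' n) (f n).

Definition is_automorphism (f : simplicial_endo) : Prop :=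
  exists f', endo_inverse f f'.

Definition automorphism_inv (f : simplicial_endo) (fA : is_automorphism f) :
  simplicial_endo := projT1 (cid fA).

Lemma automorphism_invP f (fA : is_automorphism f) :
  endo_inverse f (automorphism_inv fA).
Proof. exact: projT2 (cid fA). Qed.

End SimplicialGroupMorphisms.

(* [oc_simplex1] makes every element of [oc_vertex] a vertex. *)
Record ordered_complex := OrderedComplex {
  oc_disp : Order.disp_t;
  oc_vertex : orderType oc_disp;
  oc_simplex : {fset oc_vertex} -> Prop;
  oc_simplex_neq0 : forall s, oc_simplex s -> s != fset0;
  oc_simplex_sub : forall s t,
    oc_simplex s -> t `<=` s -> t != fset0 -> oc_simplex t;
  oc_simplex1 : forall v, oc_simplex [fset v]
}.

(* The surjection {0, ..., n+1} -> {0, ..., n} that takes the value i twice. *)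
Definition codegen n (i : 'I_n.+1) (j : 'I_n.+2) : 'I_n.+1 :=
  inord (unbump i j).

Section ComplexSimplices.
Variable K : ordered_complex.
Local Notation V := (oc_vertex K).

Record oc_chain (n : nat) := OcChain {
  oc_tuple : n.+1.-tuple V;
  oc_sorted : sorted <=%O oc_tuple;
  oc_chain_simplex : oc_simplex [fset v in (oc_tuple : seq V)]
}.

Lemma oc_chain_eq n (x y : oc_chain n) :
  (forall i, tnth (oc_tuple x) i = tnth (oc_tuple y) i) -> x = y.
Proof.
case: x y => [t ts tK] [u us uK] /= /eq_from_tnth tu.
by case: _ / tu in us uK *; congr OcChain; apply: Prop_irrelevance.
Qed.

Lemma oc_reindex_sorted m n (f : 'I_m.+1 -> 'I_n.+1) (x : oc_chain n) :
  {homo f : i j / (i <= j)%N} ->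
  sorted <=%O [tuple tnth (oc_tuple x) (f j) | j < m.+1].
Proof.
move=> fh; rewrite /= sorted_map.
have: sorted (relpre val leq) (enum 'I_m.+1).
  by rewrite -sorted_map val_enum_ord iota_sorted.
apply: sub_sorted => i j /fh /= fij.
pose v := tnth (oc_tuple x) ord0; rewrite (tnth_nth v _ (f i)) (tnth_nth v).
apply: (sorted_leq_nth (@le_trans _ _) (@le_refl _ _) _ (oc_sorted x)) fij;
  by rewrite inE size_tuple ltn_ord.
Qed.

Lemma oc_reindex_simplex m n (f : 'I_m.+1 -> 'I_n.+1) (x : oc_chain n) :
  oc_simplex
    [fset v in ([tuple tnth (oc_tuple x) (f j) | j < m.+1] : seq V)].
Proof.
apply: (oc_simplex_sub (oc_chain_simplex x)).
  apply/fsubsetP => v; rewrite !inE => /tnthP[j ->].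
  by rewrite tnth_mktuple mem_tnth.
apply/fset0Pn; exists (tnth (oc_tuple x) (f ord0)); rewrite !inE.
by apply/tnthP; exists ord0; rewrite tnth_mktuple.
Qed.

Definition oc_reindex m n (f : 'I_m.+1 -> 'I_n.+1)
    (fh : {homo f : i j / (i <= j)%N}) (x : oc_chain n) : oc_chain m :=
  OcChain (oc_reindex_sorted x fh) (oc_reindex_simplex f x).

Lemma lift_homo n (i : 'I_n.+2) : {homo lift i : j k / (j <= k)%N}.
Proof. by move=> j k jk; rewrite /= leq_bump2. Qed.

Lemma codegenE n (i : 'I_n.+1) (j : 'I_n.+2) :
  codegen i j = unbump i j :> nat.
Proof.
by rewrite inordK // /unbump; have := ltn_ord j; have := ltn_ord i; lia.
Qed.

Lemma codegen_homo n (i : 'I_n.+1) :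
  {homo @codegen n i : j k / (j <= k)%N}.
Proof. by move=> j k jk; rewrite !codegenE /unbump; lia. Qed.

Definition oc_d n (i : 'I_n.+2) : oc_chain n.+1 -> oc_chain n :=
  oc_reindex (@lift_homo n i).
Definition oc_s n (i : 'I_n.+1) : oc_chain n -> oc_chain n.+1 :=
  oc_reindex (@codegen_homo n i).

Lemma oc_simplicial : is_simplicial_set oc_d oc_s.
Proof.
split => [n i j x|n i j x|n i j x|n j x|n j x|n i j x];
  [move=> ij|move=> ij|move=> ij|idtac|idtac|move=> ij];
  apply: oc_chain_eq => k; rewrite /= !tnth_mktuple; congr tnth; apply: val_inj;
  have ? := ltn_ord k; have ? := ltn_ord j; try have ? := ltn_ord i;
  rewrite /= ?codegenE /= ?codegenE /= /unbump /bump ?inordK; try lia.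
Qed.

Lemma oc_point_sorted v : sorted <=%O [tuple v : V].
Proof. by []. Qed.

Lemma oc_point_simplex v : oc_simplex [fset w in ([tuple v : V] : seq V)].
Proof.
suff -> : [fset w in ([tuple v : V] : seq V)] = [fset v] by exact: oc_simplex1.
by apply/fsetP => w; rewrite !inE orbF.
Qed.

Definition oc_point v : oc_chain 0 :=
  OcChain (oc_point_sorted v) (oc_point_simplex v).

End ComplexSimplices.

Record small_category := SmallCategory {
  cat_obj : Type;
  cat_hom : cat_obj -> cat_obj -> Type;
  cat_id : forall v, cat_hom v v;
  cat_comp : forall u v w, cat_hom v w -> cat_hom u v -> cat_hom u w;
  cat_id_l : forall u v (a : cat_hom u v), cat_comp (cat_id v) a = a;
  cat_id_r : forall u v (a : cat_hom u v), cat_comp a (cat_id u) = a;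
  cat_assoc : forall u v w x (c : cat_hom w x) (b : cat_hom v w) (a : cat_hom u v),
    cat_comp c (cat_comp b a) = cat_comp (cat_comp c b) a
}.

Section Nerve.
Variable C : small_category.
Local Notation V := (cat_obj C).

(* [path_from n v] is the type of n-paths v alpha_1 v_1 ... alpha_n v_n. *)
Fixpoint path_from (n : nat) (v : V) : Type :=
  if n is m.+1 then {w : V & (cat_hom v w * path_from m w)%type} else unit.

Definition nerve (n : nat) : Type := {v : V & path_from n v}.

Fixpoint path_vertex n (v : V) : path_from n v -> nat -> V :=
  match n with
  | 0 => fun _ _ => v
  | m.+1 => fun p k =>
      if k is k'.+1 then path_vertex (projT2 p).2 k' else v
  end.

Definition nerve_vertex n (x : nerve n) (k : 'I_n.+1) : V :=
  path_vertex (projT2 x) k.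

(* The face d_(k+1), which keeps the first vertex.  On a path of length 1 only
   d_1 remains: it deletes the last vertex and its arrow. *)
Fixpoint path_d n (k : nat) (v : V) : path_from n.+1 v -> path_from n v :=
  match n return path_from n.+1 v -> path_from n v with
  | 0 => fun _ => tt
  | m.+1 => fun p =>
      let: existT w (a, q) := p in
      if k is k'.+1 then existT _ w (a, path_d k' q)
      else let: existT u (b, r) := q in existT _ u (cat_comp b a, r)
  end.

Definition nerve_face n (k : nat) (x : nerve n.+1) : nerve n :=
  if k is k'.+1 then existT _ (projT1 x) (path_d k' (projT2 x))
  else existT _ (projT1 (projT2 x)) (projT2 (projT2 x)).2.

Definition nerve_d : faces nerve := fun n i => nerve_face i.

Fixpoint path_s n (k : nat) (v : V) : path_from n v -> path_from n.+1 v :=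
  match n return path_from n v -> path_from n.+1 v with
  | 0 => fun p => existT _ v (cat_id v, p)
  | m.+1 => fun p =>
      if k is k'.+1 then
        let: existT w (a, q) := p in existT _ w (a, path_s k' q)
      else existT _ v (cat_id v, p)
  end.

Definition nerve_degen n (k : nat) (x : nerve n) : nerve n.+1 :=
  existT _ (projT1 x) (path_s k (projT2 x)).

Definition nerve_s : degens nerve := fun n i => nerve_degen i.

Lemma path_dd n (i j : nat) v (p : path_from n.+2 v) : (j <= i <= n)%N ->
  path_d i (path_d j p) = path_d j (path_d i.+1 p).
Proof.
elim: n i j v p => [|n IHn] [|i] [|j] v [w [a [u [b q]]]] //=.
- by case: q => x [c r]; rewrite cat_assoc.
- by move=> ij; have -> := IHn i j w (existT _ u (b, q)) ij.
Qed.

Lemma path_ss n (i j : nat) v (p : path_from n v) : (i <= j <= n)%N ->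
  path_s i (path_s j p) = path_s j.+1 (path_s i p).
Proof.
elim: n i j v p => [|n IHn] [|i] [|j] v p //=; case: p => w [a q] //= ij.
by have := IHn i j w q ij => /= ->.
Qed.

Lemma path_ds_lt n (i j : nat) v (p : path_from n.+1 v) : (i < j <= n)%N ->
  path_d i (path_s j.+1 p) = path_s j (path_d i p).
Proof.
elim: n i j v p => [|n IHn] [|i] [|j] v [w [a q]] //=; try lia.
  by case: q => u [b r].
by move=> ij; have := IHn i j w q ij => /= ->.
Qed.

Lemma path_ds_eq n (j : nat) v (p : path_from n v) : (j < n)%N ->
  path_d j (path_s j.+1 p) = p.
Proof.
elim: n j v p => [|n IHn] [|j] v // [w [a q]] /=.
  by case: n {IHn} q => [|n] q; rewrite /= cat_id_l.
by move=> jn; rewrite IHn.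
Qed.

Lemma path_ds_eqS n (j : nat) v (p : path_from n v) : (j <= n)%N ->
  path_d j (path_s j p) = p.
Proof.
elim: n j v p => [|n IHn] [|j] v; try by case.
- by case=> w [a q] /=; rewrite cat_id_r.
- by case=> w [a q] /= jn; rewrite IHn.
Qed.

Lemma path_ds_gt n (i j : nat) v (p : path_from n.+1 v) : (j <= i <= n)%N ->
  path_d i.+1 (path_s j p) = path_s j (path_d i p).
Proof.
elim: n i j v p => [|n IHn] [|i] [|j] v [w [a q]] //=; try lia.
by move=> ij; have := IHn i j w q ij => /= ->.
Qed.

Lemma nerve_simplicial : is_simplicial_set nerve_d nerve_s.
Proof.
split=> [n [i li] [j lj] [v p] /= h|n [i li] [j lj] [v p] /= h
        |n [i li] [j lj] [v p] /= h|n [j lj] [v p]|n [j lj] [v p]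
        |n [i li] [j lj] [v p] /= h];
  rewrite /nerve_d /nerve_s ?inordK; try (simpl; lia).
- case: i j li lj h => [|i] [|j] //= li lj h.
  + by case: p => w [a [u [b q]]].
  + by case: p => w [a [u [b q]]].
  + by congr existT; apply: path_dd => /=; lia.
- by congr existT; apply: path_ss => /=; lia.
- rewrite /=; case: i li h => [|i] li h; first by case: p => w [a q].
  by case: j lj h => // j lj h; congr existT; apply: path_ds_lt => /=; lia.
- rewrite /=; case: j lj => [|j] lj; first by case: n p {lj}.
  by congr existT; apply: path_ds_eq => /=; lia.
- by congr existT; apply: path_ds_eqS => /=; lia.
- rewrite /=; case: i li h => [|i] li h //.
  by congr existT; apply: path_ds_gt => /=; lia.
Qed.

Definition nerve_point (v : V) : nerve 0 := existT _ v tt.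

End Nerve.

Inductive base :=
  | Complex of ordered_complex
  | Category of small_category.

Definition vertex (A : base) : Type :=
  match A with
  | Complex K => oc_vertex K
  | Category C => cat_obj C
  end.

Definition simplices (A : base) : simplicial_set :=
  match A with
  | Complex K => SimplicialSet (oc_simplicial K)
  | Category C => SimplicialSet (nerve_simplicial C)
  end.

Definition simplex_vertex (A : base) (n : nat) :
    simplices A n -> 'I_n.+1 -> vertex A :=
  match A with
  | Complex K => fun x => tnth (oc_tuple x)
  | Category C => fun x => nerve_vertex x
  end.

Definition simplex_point (A : base) : vertex A -> simplices A 0%N :=
  match A with
  | Complex K => @oc_point K
  | Category C => @nerve_point C
  end.

Definition basepoint (A : base) (a0 : vertex A) (n : nat) : simplices A n :=
  const_simplex (simplex_point a0) n.

(* In a complex: v and w are the end points of an edge. *)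
Definition joined (A : base) : vertex A -> vertex A -> Prop :=
  match A with
  | Complex K => fun v w => v != w /\ oc_simplex [fset v; w]
  | Category C => fun v w => inhabited (cat_hom v w) \/ inhabited (cat_hom w v)
  end.

Section GroupHom.
Variables (G H : groupType) (f : {multiplicative G -> H}).

Lemma hom1 : f 1 = 1.
Proof. by apply: (@mulgI _ (f 1)); rewrite -gmulfM !mulg1. Qed.

Lemma homV x : f x^-1 = (f x)^-1.
Proof. by apply: (@mulgI _ (f x)); rewrite -gmulfM !mulgV hom1. Qed.

End GroupHom.

Section FreeProduct.
Variables (I : Type) (G : I -> groupType).

Definition fp_word : Type := seq {i : I & G i}.
HB.instance Definition _ := gen_eqMixin fp_word.
HB.instance Definition _ := gen_choiceMixin fp_word.

Definition letter i (g : G i) : {i : I & G i} := existT _ i g.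

(* The congruence on words whose quotient is the free product of the G i. *)
Inductive fp_eq : fp_word -> fp_word -> Prop :=
  | fp_eq_refl u : fp_eq u u
  | fp_eq_sym u v : fp_eq u v -> fp_eq v u
  | fp_eq_trans u v w : fp_eq u v -> fp_eq v w -> fp_eq u w
  | fp_eq_one u v i : fp_eq (u ++ letter (1 : G i) :: v) (u ++ v)
  | fp_eq_mul u v i (g h : G i) :
      fp_eq (u ++ letter g :: letter h :: v) (u ++ letter (g * h) :: v).

Definition fp_eqb (u v : fp_word) : bool := `[< fp_eq u v >].

Lemma fp_eqb_refl : reflexive fp_eqb.
Proof. by move=> u; apply/asboolP; apply: fp_eq_refl. Qed.
Lemma fp_eqb_sym : symmetric fp_eqb.
Proof. by move=> u v; apply/asboolP/asboolP; apply: fp_eq_sym. Qed.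
Lemma fp_eqb_trans : transitive fp_eqb.
Proof.
by move=> v u w /asboolP uv /asboolP vw; apply/asboolP; apply: fp_eq_trans vw.
Qed.

Canonical fp_equiv := EquivRel fp_eqb fp_eqb_refl fp_eqb_sym fp_eqb_trans.

Definition free_product : Type := {eq_quot fp_equiv}.
HB.instance Definition _ := Choice.on free_product.
HB.instance Definition _ := Quotient.on free_product.

Definition fp_class (u : fp_word) : free_product := \pi_free_product u.

Lemma fp_classP u v : fp_class u = fp_class v <-> fp_eq u v.
Proof.
by split=> [/eqmodP/asboolP//|uv]; apply/eqmodP/asboolP.
Qed.

Lemma fp_class_repr x : fp_class (repr x) = x.
Proof. exact: reprK. Qed.

Lemma fp_eq_cat u u' v v' : fp_eq u u' -> fp_eq v v' -> fp_eq (u ++ v) (u' ++ v').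
Proof.
move=> uu' vv'; apply: (@fp_eq_trans _ (u' ++ v)).
  elim: uu' => {u u' v' vv'} [u|u u' _|u u' u'' _ + _|u u' i|u u' i g h].
  - exact: fp_eq_refl.
  - exact: fp_eq_sym.
  - exact: fp_eq_trans.
  - by rewrite -!catA; apply: fp_eq_one.
  - by rewrite -!catA; apply: fp_eq_mul.
elim: vv' => {u uu' v v'} [v|v v' _|v v' v'' _ + _|v v' i|v v' i g h].
- exact: fp_eq_refl.
- exact: fp_eq_sym.
- exact: fp_eq_trans.
- by rewrite !catA; apply: fp_eq_one.
- by rewrite !catA; apply: fp_eq_mul.
Qed.

Definition winv (u : fp_word) : fp_word :=
  rev [seq letter (tagged l : G (tag l))^-1 | l : {i : I & G i} <- u].

Lemma winv_cat u v : winv (u ++ v) = winv v ++ winv u.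
Proof. by rewrite /winv map_cat rev_cat. Qed.

Lemma winvK : involutive winv.
Proof.
move=> u; rewrite /winv map_rev revK -map_comp -[RHS]map_id.
by apply: eq_map => -[i g] /=; rewrite invgK.
Qed.

Lemma fp_eq_winv u : fp_eq (winv u ++ u) [::].
Proof.
elim: u => [|[i g] u IHu]; first exact: fp_eq_refl.
rewrite -cat1s winv_cat -catA catA.
apply: fp_eq_trans IHu; rewrite -catA; apply: fp_eq_cat; first exact: fp_eq_refl.
apply: (fp_eq_trans (fp_eq_mul [::] u g^-1 g)); rewrite mulVg.
exact: (fp_eq_one [::]).
Qed.

Lemma fp_winv_eq u v : fp_eq u v -> fp_eq (winv u) (winv v).
Proof.
move=> uv; apply: (@fp_eq_trans _ (winv u ++ (v ++ winv v))).
  rewrite -[X in fp_eq X _]cats0; apply: fp_eq_cat; first exact: fp_eq_refl.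
  by apply: fp_eq_sym; rewrite -{1}[v]winvK; apply: fp_eq_winv.
rewrite catA -[X in fp_eq _ X]cat0s; apply: fp_eq_cat; last exact: fp_eq_refl.
apply: fp_eq_trans (fp_eq_winv u).
by apply: fp_eq_cat; [apply: fp_eq_refl|apply: fp_eq_sym].
Qed.

Definition fp_one : free_product := fp_class [::].
Definition fp_mul (x y : free_product) := fp_class (repr x ++ repr y).
Definition fp_inv (x : free_product) := fp_class (winv (repr x)).

Lemma fp_classM u v : fp_class (u ++ v) = fp_mul (fp_class u) (fp_class v).
Proof.
by apply/fp_classP/fp_eq_cat; apply/fp_classP; rewrite fp_class_repr.
Qed.

Lemma fp_classV u : fp_class (winv u) = fp_inv (fp_class u).
Proof. by apply/fp_classP/fp_winv_eq/fp_classP; rewrite fp_class_repr. Qed.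

Lemma fp_ind (P : free_product -> Prop) :
  (forall u, P (fp_class u)) -> forall x, P x.
Proof. by move=> Pu x; rewrite -[x]fp_class_repr. Qed.

Lemma fp_mulA : associative fp_mul.
Proof.
elim/fp_ind=> u; elim/fp_ind=> v; elim/fp_ind=> w.
by rewrite -!fp_classM catA.
Qed.
Lemma fp_mul1 : left_id fp_one fp_mul.
Proof. by elim/fp_ind=> u; rewrite -fp_classM. Qed.
Lemma fp_1mul : right_id fp_one fp_mul.
Proof. by elim/fp_ind=> u; rewrite -fp_classM cats0. Qed.
Lemma fp_mulV : left_inverse fp_one fp_inv fp_mul.
Proof.
elim/fp_ind=> u; rewrite -fp_classV -fp_classM.
by apply/fp_classP/fp_eq_winv.
Qed.
Lemma fp_Vmul : right_inverse fp_one fp_inv fp_mul.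
Proof.
elim/fp_ind=> u; rewrite -fp_classV -fp_classM.
by apply/fp_classP; rewrite -{1}[u]winvK; apply: fp_eq_winv.
Qed.

HB.instance Definition _ := isGroup.Build free_product
  fp_mulA fp_mul1 fp_1mul fp_mulV fp_Vmul.

Definition fp_in i (g : G i) : free_product := fp_class [:: letter g].

Lemma fp_inM i : {morph @fp_in i : g h / g * h}.
Proof.
move=> g h; rewrite [RHS]/mul /= -fp_classM; apply/fp_classP/fp_eq_sym.
exact: (fp_eq_mul [::] [::]).
Qed.
HB.instance Definition _ i :=
  isMultiplicative.Build (G i) free_product (@fp_in i) (@fp_inM i).

Section Lift.
Variables (H : groupType) (f : forall i, {multiplicative G i -> H}).

Definition word_lift (u : fp_word) : H :=
  \big[*%g/1]_(l <- u) f (tag l) (tagged l).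

Lemma word_lift_eq u v : fp_eq u v -> word_lift u = word_lift v.
Proof.
elim=> {u v} [|u v _ ->|u v w _ -> _ ->|u v i|u v i g h] //;
  rewrite /word_lift !big_cat !big_cons /=.
- by rewrite hom1 mul1g.
- by rewrite gmulfM -mulgA.
Qed.

Definition fp_lift (x : free_product) : H := word_lift (repr x).

Lemma fp_lift_class u : fp_lift (fp_class u) = word_lift u.
Proof. by apply/word_lift_eq/fp_classP; rewrite fp_class_repr. Qed.

Lemma fp_liftM : {morph fp_lift : x y / x * y}.
Proof.
elim/fp_ind=> u; elim/fp_ind=> v.
by rewrite [in LHS]/mul /= -fp_classM !fp_lift_class /word_lift big_cat.
Qed.
HB.instance Definition _ :=
  isMultiplicative.Build free_product H fp_lift fp_liftM.

Lemma fp_lift_in i (g : G i) : fp_lift (fp_in g) = f i g.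
Proof. by rewrite fp_lift_class /word_lift big_seq1. Qed.

End Lift.

Lemma fp_ext (H : groupType) (f f' : {multiplicative free_product -> H}) :
  (forall i (g : G i), f (fp_in g) = f' (fp_in g)) -> f =1 f'.
Proof.
move=> ff'; elim/fp_ind; elim=> [|[i g] u IHu]; first by rewrite !hom1.
by rewrite -cat1s fp_classM !gmulfM IHu; congr (_ * _); apply: ff'.
Qed.

End FreeProduct.

Section QuotientByRelations.
Variables (H : groupType) (R : H -> Prop).

Inductive normal_closure : H -> Prop :=
  | nc_rel x : R x -> normal_closure x
  | nc_one : normal_closure 1
  | nc_mul x y : normal_closure x -> normal_closure y -> normal_closure (x * y)
  | nc_inv x : normal_closure x -> normal_closure x^-1
  | nc_conj x y : normal_closure x -> normal_closure (x ^ y).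

Definition coset_eqb (x y : H) : bool := `[< normal_closure (x * y^-1) >].

Lemma coset_eqb_refl : reflexive coset_eqb.
Proof. by move=> x; apply/asboolP; rewrite mulgV; apply: nc_one. Qed.
Lemma coset_eqb_sym : symmetric coset_eqb.
Proof.
by move=> x y; apply/asboolP/asboolP => /nc_inv; rewrite invgM invgK.
Qed.
Lemma coset_eqb_trans : transitive coset_eqb.
Proof.
move=> y x z /asboolP xy /asboolP yz; apply/asboolP.
by have := nc_mul xy yz; rewrite mulgA mulgVK.
Qed.

Canonical coset_equiv :=
  EquivRel coset_eqb coset_eqb_refl coset_eqb_sym coset_eqb_trans.

Definition quotient_by : Type := {eq_quot coset_equiv}.
HB.instance Definition _ := Choice.on quotient_by.
HB.instance Definition _ := Quotient.on quotient_by.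

Definition q_class (x : H) : quotient_by := \pi_quotient_by x.

Lemma q_classP x y : q_class x = q_class y <-> normal_closure (x * y^-1).
Proof. by split=> [/eqmodP/asboolP//|xy]; apply/eqmodP/asboolP. Qed.

Lemma q_class_repr x : q_class (repr x) = x.
Proof. exact: reprK. Qed.

Definition q_mul (x y : quotient_by) := q_class (repr x * repr y).
Definition q_inv (x : quotient_by) := q_class (repr x)^-1.

Lemma q_ind (P : quotient_by -> Prop) :
  (forall x, P (q_class x)) -> forall x, P x.
Proof. by move=> Px x; rewrite -[x]q_class_repr. Qed.

Lemma q_mulE x y : q_class (x * y) = q_mul (q_class x) (q_class y).
Proof.
apply/q_classP; set x' := repr _; set y' := repr _.
have /q_classP xx' : q_class x = q_class x' by rewrite q_class_repr.
have /q_classP yy' : q_class y = q_class y' by rewrite q_class_repr.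
have -> : x * y * (x' * y')^-1 = (y * y'^-1) ^ x^-1 * (x * x'^-1).
  by rewrite conjgE invgK invgM !mulgA mulgVK.
by apply: nc_mul => //; apply: nc_conj.
Qed.

Lemma q_invE x : q_class x^-1 = q_inv (q_class x).
Proof.
apply/q_classP; set x' := repr _; rewrite invgK.
have /q_classP/nc_inv : q_class x = q_class x' by rewrite q_class_repr.
by rewrite invgM invgK => /(nc_conj x); rewrite conjgE mulgVK.
Qed.

Lemma q_mulA : associative q_mul.
Proof.
by elim/q_ind=> x; elim/q_ind=> y; elim/q_ind=> z; rewrite -!q_mulE mulgA.
Qed.
Lemma q_mul1 : left_id (q_class 1) q_mul.
Proof. by elim/q_ind=> x; rewrite -q_mulE mul1g. Qed.
Lemma q_1mul : right_id (q_class 1) q_mul.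
Proof. by elim/q_ind=> x; rewrite -q_mulE mulg1. Qed.
Lemma q_mulV : left_inverse (q_class 1) q_inv q_mul.
Proof. by elim/q_ind=> x; rewrite -q_invE -q_mulE mulVg. Qed.
Lemma q_Vmul : right_inverse (q_class 1) q_inv q_mul.
Proof. by elim/q_ind=> x; rewrite -q_invE -q_mulE mulgV. Qed.

HB.instance Definition _ := isGroup.Build quotient_by
  q_mulA q_mul1 q_1mul q_mulV q_Vmul.

Lemma q_classM : {morph q_class : x y / x * y}.
Proof. exact: q_mulE. Qed.
HB.instance Definition _ :=
  isMultiplicative.Build H quotient_by q_class q_classM.

Section Lift.
Variables (K : groupType) (f : {multiplicative H -> K}).

Definition q_lift (fR : forall x, R x -> f x = 1) (x : quotient_by) : K :=
  f (repr x).

Hypothesis fR : forall x, R x -> f x = 1.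

Lemma normal_closure_ker x : normal_closure x -> f x = 1.
Proof.
elim=> {x} [x /fR //||x y _ fx _ fy|x _ fx|x y _ fx].
- exact: hom1.
- by rewrite gmulfM fx fy mulg1.
- by rewrite homV fx invg1.
- by rewrite conjgE !gmulfM fx mul1g -gmulfM mulVg hom1.
Qed.

Lemma q_lift_class x : q_lift fR (q_class x) = f x.
Proof.
have /q_classP/normal_closure_ker := q_class_repr (q_class x).
by rewrite gmulfM homV => /divg1_eq.
Qed.

Lemma q_liftM : {morph q_lift fR : x y / x * y}.
Proof.
elim/q_ind=> x; elim/q_ind=> y.
by rewrite -q_classM !q_lift_class gmulfM.
Qed.
HB.instance Definition _ :=
  isMultiplicative.Build quotient_by K (q_lift fR) q_liftM.

End Lift.

Lemma q_ext (K : groupType) (f f' : {multiplicative quotient_by -> K}) :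
  (forall x, f (q_class x) = f' (q_class x)) -> f =1 f'.
Proof. by move=> ff'; elim/q_ind. Qed.

End QuotientByRelations.

Section ConstSimplex.
Variables (X : simplicial_set) (x0 : X 0%N).

Lemma const_simplex_d n (i : 'I_n.+2) :
  sset_d i (const_simplex x0 n.+1) = const_simplex x0 n.
Proof.
have [_ _ _ ds0 ds1 dsS] := sset_ax X.
elim: n i => [|n IHn] i /=; case: (ltnP 1 i) => i1.
- by have := ltn_ord i; lia.
- have [i0|i0] : i = inord 0 \/ i = inord 1.
  + by case: i i1 => [[|[|i]] li] //= _; [left|right]; apply: val_inj;
      rewrite /= inordK.
  + by rewrite i0 (ds0 0%N ord0).
  + by rewrite i0 (ds1 0%N ord0).
- have ib := ltn_ord i.
  have -> : i = inord (inord i.-1 : 'I_n.+2).+1.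
    by apply: val_inj; rewrite /= !inordK; lia.
  have -> : @ord0 n.+1 = inord (@ord0 n).
    by apply: val_inj; rewrite /= inordK.
  rewrite (dsS n (inord i.-1) ord0) /=; last by rewrite inordK; lia.
  by rewrite -[sset_s ord0 (const_simplex x0 n)]/(const_simplex x0 n.+1) IHn.
- have [i0|i0] : i = inord 0 \/ i = inord 1.
  + by case: i i1 => [[|[|i]] li] //= _; [left|right]; apply: val_inj;
      rewrite /= inordK.
  + by rewrite i0 (ds0 n.+1 ord0).
  + by rewrite i0 (ds1 n.+1 ord0).
Qed.

Lemma const_simplex_s n (i : 'I_n.+1) :
  sset_s i (const_simplex x0 n) = const_simplex x0 n.+1.
Proof.
have [_ ss _ _ _ _] := sset_ax X.
elim: n i => [|n IHn] i; first by rewrite (ord1 i).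
have [i0|i0] := posnP i.
  by congr (sset_s _ _); apply: val_inj.
have ib := ltn_ord i.
have -> : i = inord (inord i.-1 : 'I_n.+1).+1.
  by apply: val_inj; rewrite /= !inordK; lia.
rewrite /= -(ss n ord0 (inord i.-1)) // IHn.
by congr (sset_s _ _); apply: val_inj; rewrite /= inordK.
Qed.

End ConstSimplex.

Section TwistedStructure.
Variables (A : base) (a0 : vertex A) (G : simplicial_group).

(* F^G[A]_n is the free product of the copies of G_n indexed by the n-simplices,
   modulo the copy at the basepoint. *)
Definition FG_relator n (w : free_product (fun _ : simplices A n => G n)) : Prop :=
  exists g : G n, w = @fp_in _ (fun _ => G n) (basepoint a0 n) g.

Definition FG (n : nat) : groupType := quotient_by (@FG_relator n).

(* The generator g_x. *)
Definition FG_gen n (x : simplices A n) (g : G n) : FG n :=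
  q_class (@FG_relator n) (@fp_in _ (fun _ => G n) x g).

Lemma FG_genM n (x : simplices A n) : {morph @FG_gen n x : g h / g * h}.
Proof. by move=> g h; rewrite /FG_gen !gmulfM. Qed.
HB.instance Definition _ n (x : simplices A n) :=
  isMultiplicative.Build (G n) (FG n) (@FG_gen n x) (@FG_genM n x).

Lemma FG_gen0 n (g : G n) : FG_gen (basepoint a0 n) g = 1.
Proof.
by apply/q_classP; rewrite invg1 mulg1; apply: nc_rel; exists g.
Qed.

Lemma FG_ext n (H : groupType) (f f' : {multiplicative FG n -> H}) :
  (forall x g, f (FG_gen x g) = f' (FG_gen x g)) -> f =1 f'.
Proof.
move=> ff'; apply: q_ext.
exact: (@fp_ext _ _ _ (f \o q_class _) (f' \o q_class _)).
Qed.

Section Lift.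
Variables (n : nat) (H : groupType).
Variable f : simplices A n -> {multiplicative G n -> H}.
Hypothesis f0 : forall g, f (basepoint a0 n) g = 1.

Lemma FG_lift_subproof w : FG_relator w -> fp_lift f w = 1.
Proof. by case=> g ->; rewrite fp_lift_in. Qed.

(* The group homomorphism determined by g_x |-> f x g. *)
Definition FG_lift : {multiplicative FG n -> H} := q_lift FG_lift_subproof.

Lemma FG_lift_gen x g : FG_lift (FG_gen x g) = f x g.
Proof. by rewrite [LHS]q_lift_class; apply: fp_lift_in. Qed.

End Lift.

Variable delta : vertex A -> simplicial_endo G.

Definition is_twisted_structure : Prop :=
  forall v w, joined v w ->
  forall n, delta v n \o delta w n =1 delta w n \o delta v n.

Definition non_singular : Prop := forall v, is_automorphism (delta v).

Section TwistedFace.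
Variables (n : nat) (i : 'I_n.+2).

Definition twisted_d_gen (x : simplices A n.+1) : {multiplicative G n.+1 -> FG n} :=
  FG_gen (sset_d i x) \o (delta (simplex_vertex x i) n \o sgroup_d i).

Lemma twisted_d_gen0 g : twisted_d_gen (basepoint a0 n.+1) g = 1.
Proof. by rewrite /= const_simplex_d FG_gen0. Qed.

End TwistedFace.

Definition twisted_d : faces FG := fun n i => FG_lift (@twisted_d_gen0 n i).

Lemma twisted_dE n (i : 'I_n.+2) (x : simplices A n.+1) (g : G n.+1) :
  twisted_d i (FG_gen x g) =
  FG_gen (sset_d i x) (delta (simplex_vertex x i) n (sgroup_d i g)).
Proof. exact: FG_lift_gen. Qed.

Section TwistedDegeneracy.
Hypothesis deltaA : non_singular.
Variables (n : nat) (i : 'I_n.+1).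

Definition twisted_s_gen (x : simplices A n) : {multiplicative G n -> FG n.+1} :=
  FG_gen (sset_s i x) \o
    (automorphism_inv (deltaA (simplex_vertex x i)) n.+1 \o sgroup_s i).

Lemma twisted_s_gen0 g : twisted_s_gen (basepoint a0 n) g = 1.
Proof. by rewrite /= const_simplex_s FG_gen0. Qed.

End TwistedDegeneracy.

Definition twisted_s (deltaA : non_singular) : degens FG :=
  fun n i => FG_lift (@twisted_s_gen0 deltaA n i).

Lemma twisted_sE (deltaA : non_singular) n (i : 'I_n.+1)
    (x : simplices A n) (g : G n) :
  twisted_s deltaA i (FG_gen x g) =
  FG_gen (sset_s i x)
    (automorphism_inv (deltaA (simplex_vertex x i)) n.+1 (sgroup_s i g)).
Proof. exact: FG_lift_gen. Qed.

End TwistedStructure.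

Arguments twisted_d {A} a0 {G} delta n i _.
Arguments twisted_s {A} a0 {G delta} deltaA n i _.

(* Main.v *)
(** The structure maps are homomorphisms, so each simplicial identity may be
    checked on the generators g_x.  There it splits into three parts: the same
    identity in S for the index x, the same identity in G for g (the
    endomorphisms delta_v commute with the structure maps of G), and an equality
    between two composites of maps delta_v^{+-1} at the vertices of x.  Any two
    vertices of a simplex are equal or joined, so these composites agree. *)
From HB Require Import structures.
From mathcomp Require Import all_boot all_order finmap boolp zify.
Require Import Defs.

Set Implicit Arguments.
Unset Strict Implicit.
Unset Printing Implicit Defensive.

Import Order.TTheory.
Local Open Scope group_scope.
Local Open Scope fset_scope.

(** * Vertices and arrows along a path in a category *)

Section PathVertices.
Variable C : small_category.

Lemma path_vertex0 n (v : cat_obj C) (p : path_from n v) : path_vertex p 0 = v.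
Proof. by case: n p. Qed.

(** [path_d i] is the face with index [i.+1], hence the shift in [bump]. *)
Lemma path_vertex_d n (i k : nat) (v : cat_obj C) (p : path_from n.+1 v) :
  (i <= n)%N -> (k <= n)%N ->
  path_vertex (path_d i p) k = path_vertex p (bump i.+1 k).
Proof.
elim: n i k v p => [|n IHn] i k v.
  by case: i k => [|i] [|k].
case: i k => [|i] [|k] [w [a q]] //.
- by case: q => u [b r].
- by rewrite bumpS; apply: IHn.
Qed.

(** Past the end of a path [path_vertex] keeps returning the last vertex, so [k] may be any natural
    number. *)
Lemma path_vertex_s n (i k : nat) (v : cat_obj C) (p : path_from n v) :
  (i <= n)%N -> path_vertex (path_s i p) k = path_vertex p (unbump i k).
Proof.
elim: n i k v p => [|n IHn] i k v.
  by case: k => [|k].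
case: i k => [|i] [|k] // [w [a q]] ni.
- by rewrite /unbump /= subn1.
- have -> : unbump i.+1 k.+1 = (unbump i k).+1 by rewrite /unbump; lia.
  exact: IHn.
Qed.

(** Compose the arrows of the path between the two vertices; for [i = j] take an identity. *)
Lemma path_arrow n (i j : nat) (v : cat_obj C) (p : path_from n v) :
  (i <= j <= n)%N -> inhabited (cat_hom (path_vertex p i) (path_vertex p j)).
Proof.
elim: n i j v p => [|n IHn] i j v p; first by move=> _; exists; apply: cat_id.
case: i j => [|i] [|j] //; last exact: IHn.
- by move=> _; exists; apply: cat_id.
- case: p => w [a q] /= nj; have [b] := IHn 0%N j w q nj.
  by rewrite path_vertex0 in b; exists; exact: cat_comp b a.
Qed.

End PathVertices.

(** * Vertices of simplices, for both kinds of base *)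

Section SimplexVertices.
Variable A : base.

Lemma simplex_vertex_d n (i : 'I_n.+2) (x : simplices A n.+1) (k : 'I_n.+1) :
  simplex_vertex (sset_d i x) k = simplex_vertex x (lift i k).
Proof.
case: A x => [K|C] x /=; first by rewrite tnth_mktuple.
(* The face d_0 is not a [path_d]; in that case both sides agree by computation. *)
case: i x k => [[|i] li] [v p] [k lk] /=; rewrite /nerve_vertex //=.
by rewrite path_vertex_d.
Qed.

Lemma simplex_vertex_s n (i : 'I_n.+1) (x : simplices A n) (k : 'I_n.+2) :
  simplex_vertex (sset_s i x) k = simplex_vertex x (codegen i k).
Proof.
case: A x => [K|C] x /=; first by rewrite tnth_mktuple.
by rewrite /nerve_vertex path_vertex_s ?codegenE // -ltnS.
Qed.

(** In a complex the two vertices span a face, which is an edge only when they differ; hence the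
    first alternative. In a nerve the path itself supplies an arrow. *)
Lemma simplex_vertices_joined n (x : simplices A n) (i j : 'I_n.+1) :
  simplex_vertex x i = simplex_vertex x j \/
  joined (simplex_vertex x i) (simplex_vertex x j).
Proof.
case: A x => [K|C] x /=.
  have [->|xij] := eqVneq (tnth (oc_tuple x) i) (tnth (oc_tuple x) j).
    by left.
  right; split=> //; apply: (oc_simplex_sub (oc_chain_simplex x)).
    by apply/fsubsetP => v; rewrite !inE => /orP[] /eqP ->; apply: mem_tnth.
  by apply/fset0Pn; exists (tnth (oc_tuple x) i); rewrite !inE eqxx.
by right; case: (leqP i j) => ij; [left|right]; apply: path_arrow;
  have := ltn_ord i; have := ltn_ord j; lia.
Qed.

End SimplexVertices.

(** * Twisted operations as homomorphisms *)

Section TwistedMorphisms.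
Variables (A : base) (a0 : vertex A) (G : simplicial_group).
Variable delta : vertex A -> simplicial_endo G.

(** The instances of this section make composites of twisted operations homomorphisms, so that
    [FG_ext] applies to them. *)
Lemma twisted_dM n (i : 'I_n.+2) :
  {morph twisted_d a0 delta n i : x y / x * y}.
Proof. exact: gmulfM. Qed.
HB.instance Definition _ n (i : 'I_n.+2) :=
  isMultiplicative.Build (FG a0 G n.+1) (FG a0 G n) (twisted_d a0 delta n i)
    (@twisted_dM n i).

Hypothesis delta_ns : non_singular delta.

Lemma twisted_sM n (i : 'I_n.+1) :
  {morph twisted_s a0 delta_ns n i : x y / x * y}.
Proof. exact: gmulfM. Qed.
HB.instance Definition _ n (i : 'I_n.+1) :=
  isMultiplicative.Build (FG a0 G n) (FG a0 G n.+1) (twisted_s a0 delta_ns n i)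
    (@twisted_sM n i).

End TwistedMorphisms.

(** * Identities between twisted operations *)

Section TwistedIdentities.
Variables (A : base) (a0 : vertex A) (G : simplicial_group).
Variable delta : vertex A -> simplicial_endo G.
Hypothesis delta_tw : is_twisted_structure delta.

(** The degrees [n] and [m] are independent because [g] has already passed through operations of [G]
    while the vertices are still those of the original simplex. *)
Lemma delta_comm n m (x : simplices A n) (i j : 'I_n.+1) (g : G m) :
  delta (simplex_vertex x i) m (delta (simplex_vertex x j) m g) =
  delta (simplex_vertex x j) m (delta (simplex_vertex x i) m g).
Proof. by have [->//|/delta_tw] := simplex_vertices_joined x i j; apply. Qed.

Lemma twisted_d_d : is_delta_set (X := FG a0 G) (twisted_d a0 delta).
Proof.
move=> n i j w ij; move: w; have [iP jP] := (ltn_ord i, ltn_ord j).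
apply: (@FG_ext _ a0 G _ _ (twisted_d a0 delta n i \o twisted_d a0 delta n.+1 _)
  (twisted_d a0 delta n j \o twisted_d a0 delta n.+1 _)) => x g /=.
have [_ _ [dG _ _ _ _ _]] := sgroup_ax G.
have [dS _ _ _ _ _] := sset_ax (simplices A).
rewrite !twisted_dE !simplex_vertex_d -!endo_d dS // dG //.
(* Vertex i of d_j x is vertex i+1 of x, and vertex j of d_(i+1) x is vertex j of x: both sides use
   the vertices j and i+1, in opposite order. *)
have -> : lift (inord j) i = inord i.+1 :> 'I_n.+3.
  by apply: val_inj; rewrite /= !inordK /bump; lia.
have -> : lift (inord i.+1) j = inord j :> 'I_n.+3.
  by apply: val_inj; rewrite /= !inordK /bump; lia.
by rewrite delta_comm.
Qed.

Section NonSingular.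
Hypothesis delta_ns : non_singular delta.
Local Notation deltaV v := (automorphism_inv (delta_ns v)).

Lemma deltaK v n : cancel (delta v n) (deltaV v n).
Proof. by have [] := automorphism_invP (delta_ns v) n. Qed.

Lemma deltaVK v n : cancel (deltaV v n) (delta v n).
Proof. by have [] := automorphism_invP (delta_ns v) n. Qed.

(** Applying the injective [delta] at vertex [j] to both sides cancels the inverses and leaves
    [delta_comm]. *)
Lemma delta_deltaV_comm n m (x : simplices A n) (i j : 'I_n.+1) (g : G m) :
  delta (simplex_vertex x i) m (deltaV (simplex_vertex x j) m g) =
  deltaV (simplex_vertex x j) m (delta (simplex_vertex x i) m g).
Proof.
apply: (can_inj (@deltaK (simplex_vertex x j) m)).
by rewrite deltaVK delta_comm deltaVK.
Qed.

Lemma deltaV_comm n m (x : simplices A n) (i j : 'I_n.+1) (g : G m) :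
  deltaV (simplex_vertex x i) m (deltaV (simplex_vertex x j) m g) =
  deltaV (simplex_vertex x j) m (deltaV (simplex_vertex x i) m g).
Proof.
apply: (can_inj (@deltaK (simplex_vertex x i) m)).
by rewrite deltaVK delta_deltaV_comm deltaVK.
Qed.

Lemma twisted_simplicial :
  is_simplicial_set (X := FG a0 G) (twisted_d a0 delta) (twisted_s a0 delta_ns).
Proof.
have [_ _ [_ ssG dsltG dseqG dseqSG dsgtG]] := sgroup_ax G.
have [_ ssS dsltS dseqS dseqSS dsgtS] := sset_ax (simplices A).
split; first exact: twisted_d_d.
- move=> n i j w ij; move: w; have [iP jP] := (ltn_ord i, ltn_ord j).
  apply: (@FG_ext _ a0 G _ _
    (twisted_s a0 delta_ns n.+1 _ \o twisted_s a0 delta_ns n j)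
    (twisted_s a0 delta_ns n.+1 _ \o twisted_s a0 delta_ns n i)) => x g /=.
  rewrite !twisted_sE !simplex_vertex_s -!endo_s ssS // ssG //.
  (* As i <= j, repeating v_j keeps v_i at place i, and repeating v_i moves v_j to place j+1. *)
  have -> : codegen j (inord i) = i.
    by apply: val_inj; rewrite /= codegenE !inordK /unbump; lia.
  have -> : codegen i (inord j.+1) = j.
    by apply: val_inj; rewrite /= codegenE !inordK /unbump; lia.
  by rewrite deltaV_comm.
- move=> n i j w ij; move: w; have [iP jP] := (ltn_ord i, ltn_ord j).
  apply: (@FG_ext _ a0 G _ _
    (twisted_d a0 delta n.+1 _ \o twisted_s a0 delta_ns n.+1 _)
    (twisted_s a0 delta_ns n j \o twisted_d a0 delta n i)) => x g /=.
  rewrite !(twisted_sE, twisted_dE) simplex_vertex_s simplex_vertex_d.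
  rewrite -endo_d -endo_s dsltS // dsltG //.
  (* Both sides carry [delta] at v_i and the inverse at v_(j+1), which sits at place j once v_i is
     deleted. *)
  have -> : codegen (inord j.+1) (inord i) = i.
    by apply: val_inj; rewrite /= codegenE !inordK /unbump; lia.
  have -> : lift i j = inord j.+1.
    by apply: val_inj; rewrite /= !inordK /bump; lia.
  by rewrite delta_deltaV_comm.
- move=> n j; have jP := ltn_ord j.
  apply: (@FG_ext _ a0 G _ _
    (twisted_d a0 delta n _ \o twisted_s a0 delta_ns n j) idfun) => x g /=.
  rewrite twisted_sE twisted_dE simplex_vertex_s -endo_d dseqS dseqG.
  (* Places j and j+1 of s_j x both hold v_j, so either face applies [delta] at v_j and cancels the
     inverse in the degeneracy. *)
  have -> : codegen j (inord j) = j.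
    by apply: val_inj; rewrite /= codegenE !inordK /unbump; lia.
  by rewrite deltaVK.
- move=> n j; have jP := ltn_ord j.
  apply: (@FG_ext _ a0 G _ _
    (twisted_d a0 delta n _ \o twisted_s a0 delta_ns n j) idfun) => x g /=.
  rewrite twisted_sE twisted_dE simplex_vertex_s -endo_d dseqSS dseqSG.
  have -> : codegen j (inord j.+1) = j.
    by apply: val_inj; rewrite /= codegenE !inordK /unbump; lia.
  by rewrite deltaVK.
- move=> n i j w ij; move: w; have [iP jP] := (ltn_ord i, ltn_ord j).
  apply: (@FG_ext _ a0 G _ _
    (twisted_d a0 delta n.+1 _ \o twisted_s a0 delta_ns n.+1 _)
    (twisted_s a0 delta_ns n j \o twisted_d a0 delta n i)) => x g /=.
  rewrite !(twisted_sE, twisted_dE) simplex_vertex_s simplex_vertex_d.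
  rewrite -endo_d -endo_s dsgtS // dsgtG //.
  (* As j < i, repeating v_j moves v_i to place i+1, while deleting v_i leaves v_j at place j. *)
  have -> : codegen (inord j) (inord i.+1) = i.
    by apply: val_inj; rewrite /= codegenE !inordK /unbump; lia.
  have -> : lift i j = inord j.
    by apply: val_inj; rewrite /= !inordK /bump; lia.
  by rewrite delta_deltaV_comm.
Qed.

End NonSingular.
End TwistedIdentities.

Theorem proposition3p1 (A : base) (a0 : vertex A) (G : simplicial_group)
  (delta : vertex A -> simplicial_endo G) (delta_tw : is_twisted_structure delta) :
  is_delta_group (X := FG a0 G) (twisted_d a0 delta) /\
  (forall delta_ns : non_singular delta,
     is_simplicial_group (X := FG a0 G) (twisted_d a0 delta) (twisted_s a0 delta_ns)).
Proof.
split=> [|delta_ns]; split.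
- exact: twisted_dM.
- exact: twisted_d_d.
- exact: twisted_dM.
- exact: twisted_sM.
- exact: twisted_simplicial.
Qed.
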